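(* Let $\widetilde\Gamma(x)=\frac1x e^{x\log 2}\prod_{k=1}^\infty\left(e^{-x/k}(1+x/k)\right)^{(-1)^{k+1}}$. On $(0,\infty)$, $\widetilde\Gamma$ is weakly log-convex, i.e. $\widetilde\Gamma(x)>0$ for $x>0$ and $\log\widetilde\Gamma$ is (weakly) convex on $(0,\infty)$.
   Context: In the product defining $\widetilde\Gamma$, for odd $k$ the factor is $e^{-x/k}(1+x/k)$ and for even $k$ it is its reciprocal. ''Weakly convex'' means convex in the non-strict sense. *)

(* Defs.v *)
From HB Require Import structures.
From mathcomp Require Import all_boot all_order all_algebra.
From mathcomp Require Import all_classical all_reals all_analysis.

Set Implicit Arguments.
Unset Strict Implicit.
Unset Printing Implicit Defensive.

Import Order.TTheory GRing.Theory Num.Theory.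
Import numFieldNormedType.Exports.

Local Open Scope classical_set_scope.
Local Open Scope ring_scope.

Definition gammat_factor (R : realType) (x : R) (k : nat) : R :=
  (expR (- (x / k%:R)) * (1 + x / k%:R)) ^ ((-1) ^+ k.+1 : int).

(* The infinite product is the limit of the partial products over
   k = 1, ..., n.  If these diverged, [lim] would return the default point 0
   of R and [gammat x] would be 0; so [0 < gammat x] entails convergence. *)
Definition gammat (R : realType) (x : R) : R :=
  x^-1 * expR (x * ln 2) *
  lim ((\prod_(1 <= k < n.+1) gammat_factor x k) @[n --> \oo]).

(* Main.v *)
Require Import Defs.
From HB Require Import structures.
From mathcomp Require Import all_boot all_order all_algebra.
From mathcomp Require Import all_classical all_reals all_analysis.
From mathcomp Require Import ring lra.

(* The logarithms of the factors are O(1/k^2), so the product converges to a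
   positive limit.  Up to affine functions of [x], [- ln x] plus the logarithm
   of the product of the factors with [k <= 2n+1] is the sum over [j <= n] of
   [ln (1 + 1 / (x + 2j))].  Each summand is convex, and convexity passes to
   the pointwise limit. *)

Import Order.TTheory GRing.Theory Num.Theory.
Import numFieldNormedType.Exports.
Local Open Scope classical_set_scope.
Local Open Scope ring_scope.

Section ConvexFunctions.
Variables (R : realType) (D : set R^o).
Implicit Types f g : R^o -> R^o.

(** Convexity can then be checked with two plain real weights instead of one weight packed with its
    unit-interval bounds. *)
Lemma convex_functionP f :
  (forall t s x y : R, 0 <= t -> 0 <= s -> t + s = 1 -> D x -> D y ->
     f (t * x + s * y) <= t * f x + s * f y) -> convex_function D f.
Proof.
move=> cf t x y /[!inE] Dx Dy; rewrite !convRE.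
by apply: cf => //; rewrite ?unstable.onem_ge0// /unstable.onem addrC subrK.
Qed.

Lemma convex_function_affine (a b : R) :
  convex_function D (fun x : R^o => a * x + b).
Proof.
apply: convex_functionP => t s x y _ _ ts _ _.
by rewrite le_eqVlt; apply/orP; left; apply/eqP;
  rewrite -[b in LHS]mul1r -ts; ring.
Qed.

Lemma convex_functionD f g : convex_function D f -> convex_function D g ->
  convex_function D (fun x : R^o => f x + g x).
Proof.
move=> cf cg t x y xD yD.
have := lerD (cf t x y xD yD) (cg t x y xD yD).
by rewrite !convRE /= => /le_trans; apply; rewrite !mulrDr; lra.
Qed.

Lemma eq_convex_function f g : (forall x, D x -> f x = g x) -> convex_set D ->
  convex_function D f -> convex_function D g.
Proof.
move=> fg cD cf t x y xD yD.
have /set_mem Dxy := cD x y t xD yD.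
by move: (xD) (yD) => /set_mem Dx /set_mem Dy; rewrite -!fg//; exact: cf.
Qed.

(** Non-strict inequalities survive limits; convexity of [D] puts the intermediate point where
    convergence is known. *)
Lemma convex_function_cvg (f_ : nat -> R^o -> R^o) f : convex_set D ->
  (forall n, convex_function D (f_ n)) ->
  (forall x, D x -> f_ n x @[n --> \oo] --> f x) -> convex_function D f.
Proof.
move=> cD cf fcv t x y xD yD.
have /set_mem Dxy := cD x y t xD yD.
move: (xD) (yD) => /set_mem Dx /set_mem Dy.
have lxy := fcv _ Dxy.
have r : t%:num * f_ n x + (1 - t%:num) * f_ n y @[n --> \oo] -->
    t%:num * f x + (1 - t%:num) * f y.
  by apply: cvgD; apply: cvgMl_tmp; exact: fcv.
rewrite [leRHS]convRE.
rewrite -(cvg_lim (@Rhausdorff R) lxy) -(cvg_lim (@Rhausdorff R) r).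
apply: ler_lim; [exact: cvgP lxy|exact: cvgP r|].
by apply: nearW => n; have := cf n t x y xD yD; rewrite [leRHS]convRE.
Qed.

End ConvexFunctions.

Section Gammat.
Variable R : realType.
Implicit Types x y : R.

(** This is [ln (1 + u) <= u] at [u = y^-1 - 1]. *)
Lemma ge_ln_subV y : 0 < y -> 1 - y^-1 <= ln y.
Proof.
move=> y0; have iy0 : 0 < y^-1 by rewrite invr_gt0.
have := @le_ln1Dx R (y^-1 - 1); rewrite [1 + _]addrC subrK lnV ?posrE//.
have -> : -1 < y^-1 - 1 by lra.
by move=> /(_ isT); lra.
Qed.

(* The tangent line at [z] lies below the graph: [ln u >= 1 - u^-1] bounds
   the difference of the two values by [(z - w) / ((w + 1) * z)], which is at
   least [(z - w) / ((z + 1) * z)], linear in [w]. *)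
Lemma ln1DV_tangent (z w : R) : 0 < z -> 0 < w ->
  ln (1 + z^-1) + (z - w) / ((z + 1) * z) <= ln (1 + w^-1).
Proof.
move=> z0 w0.
have pz : 0 < 1 + z^-1 by rewrite addr_gt0// invr_gt0.
have pw : 0 < 1 + w^-1 by rewrite addr_gt0// invr_gt0.
have := ge_ln_subV ((1 + w^-1) / (1 + z^-1)) (divr_gt0 pw pz).
rewrite ln_div ?posrE// lerBrDl; apply: le_trans; rewrite lerD2l.
rewrite -subr_ge0.
have -> : 1 - ((1 + w^-1) / (1 + z^-1))^-1 - (z - w) / ((z + 1) * z) =
   (z - w) ^+ 2 / (z * (z + 1) * (w + 1)).
  by field; apply/and4P; split; apply: lt0r_neq0; lra.
by rewrite divr_ge0 ?sqr_ge0// !mulr_ge0//; lra.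
Qed.

Lemma convex_set_pos : convex_set (`]0, +oo[%classic : set R^o).
Proof.
apply/convex_setW => x y; rewrite !inE/= !in_itv/= !andbT => x0 y0 t t0 t1.
rewrite inE/= in_itv/= andbT; apply: addr_gt0; apply: mulr_gt0 => //.
exact: unstable.onem_gt0.
Qed.

(** Average the tangent-line inequality at [z], the shifted convex combination, over [x + c] and
    [y + c]: the linear terms cancel. *)
Lemma convex_ln1DV (c : R) : 0 <= c ->
  convex_function (`]0, +oo[%classic : set R^o)
    (fun x : R^o => ln (1 + (x + c)^-1)).
Proof.
move=> c0; apply: convex_functionP => t s x y t0 s0 ts.
rewrite /= !in_itv/= !andbT => x0 y0.
set z := t * x + s * y + c.
have Ez : z = t * (x + c) + s * (y + c).
  by rewrite /z -[c in LHS]mul1r -ts; ring.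
have z0 : 0 < z.
  rewrite /z; have [t1|t1] := ltP 0 t.
    by have := mulr_gt0 t1 x0; have := mulr_ge0 s0 (ltW y0); lra.
  by have -> : s = 1 by [lra]; have -> : t = 0 by [lra]; lra.
have px : 0 < x + c by lra.
have py : 0 < y + c by lra.
have := lerD (ler_wpM2l t0 (ln1DV_tangent z (x + c) z0 px))
  (ler_wpM2l s0 (ln1DV_tangent z (y + c) z0 py)).
apply: le_trans; set K := ((z + 1) * z)^-1.
have -> : t * (ln (1 + z^-1) + (z - (x + c)) * K) +
  s * (ln (1 + z^-1) + (z - (y + c)) * K) =
  (t + s) * ln (1 + z^-1) + ((t + s) * z - (t * (x + c) + s * (y + c))) * K by ring.
by rewrite ts -Ez !mul1r subrr mul0r addr0.
Qed.

(** Series start at 0, so index [i] stands for the factor [k = i + 1], whose exponent (-1)^(k+1)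
    equals (-1)^i. *)
Definition gammat_ln_term x (i : nat) : R :=
  (-1) ^+ i * (ln (1 + x / i.+1%:R) - x / i.+1%:R).

Lemma gammat_factorE x i : 0 < x ->
  gammat_factor x i.+1 = expR (gammat_ln_term x i).
Proof.
move=> x0; rewrite /gammat_factor /gammat_ln_term.
have u0 : 0 < 1 + x / i.+1%:R by rewrite addr_gt0// divr_gt0.
rewrite -{1}(lnK u0) -expRD addrC !exprS !mulN1r opprK.
rewrite -signr_odd -[in RHS]signr_odd; case: odd => /=.
  by rewrite expr1 mulN1r expRN.
by rewrite !expr0 mul1r.
Qed.

Lemma gammat_prodE x n : 0 < x ->
  \prod_(1 <= k < n.+1) gammat_factor x k = expR (series (gammat_ln_term x) n).
Proof.
move=> x0; rewrite seriesEnat/= expR_sum big_add1 /=.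
by apply: eq_bigr => i _; rewrite gammat_factorE.
Qed.

(** With [u = x / k], 0 <= u - ln (1 + u) <= u^2 / (1 + u) = x^2 / (k (k + x)). The constant 2
    absorbs k + 1 <= 2k, which makes the bound telescope. *)
Lemma gammat_ln_term_le x i : 0 < x ->
  `|gammat_ln_term x i| <= 2 * x ^+ 2 * (i.+1%:R^-1 - i.+2%:R^-1).
Proof.
move=> x0; rewrite normrM normrX normrN1 expr1n mul1r.
have k1 : 1 <= i.+1%:R :> R by rewrite ler1n.
rewrite -[in i.+2]addn1 natrD; move: (i.+1%:R) k1 => k k1.
have k0 : 0 < k by lra.
have u0 : 0 < x / k by rewrite divr_gt0.
have h1 : ln (1 + x / k) <= x / k by apply: le_ln1Dx; lra.
have h2 : 1 - (1 + x / k)^-1 <= ln (1 + x / k) by apply: ge_ln_subV; lra.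
rewrite ler0_norm; last lra.
apply: (@le_trans _ _ (x / k - (1 - (1 + x / k)^-1))); first lra.
rewrite -subr_ge0.
have -> : 2 * x ^+ 2 * (k^-1 - (k + 1)^-1) - (x / k - (1 - (1 + x / k)^-1)) =
  x ^+ 2 * (k - 1 + 2 * x) / (k * (k + 1) * (k + x)).
  by field; apply/and3P; split; apply/lt0r_neq0; lra.
by rewrite divr_ge0 ?mulr_ge0 ?sqr_ge0//; lra.
Qed.

Lemma cvg_gammat_ln_term x : 0 < x -> cvgn (series (gammat_ln_term x)).
Proof.
move=> x0; apply: normed_cvg.
(* [harmonic n] is the single term 1/(n+1), which tends to 0, so the partial sums of [v]
   converge. *)
pose v := telescope (fun n => - (2 * x ^+ 2) * harmonic n : R).
have vE n : v n = 2 * x ^+ 2 * (n.+1%:R^-1 - n.+2%:R^-1).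
  by rewrite /v /telescope /harmonic /=; ring.
have lv n : `|gammat_ln_term x n| <= v n by rewrite vE gammat_ln_term_le.
apply: (series_le_cvg _ _ lv) => [n|n|]; first exact: normr_ge0.
  by apply: le_trans (lv n).
rewrite /v telescopeK; apply: is_cvgB; last exact: is_cvg_cst.
by apply: is_cvgMl_tmp; apply/cvg_ex; exists 0; exact: cvg_harmonic.
Qed.

(** The partial products are exponentials of convergent sums, so by continuity [lim] is a genuine
    limit here, not the default 0. *)
Lemma gammatE x : 0 < x ->
  gammat x = x^-1 * expR (x * ln 2) * expR (limn (series (gammat_ln_term x))).
Proof.
move=> x0; rewrite /gammat; congr (_ * _).
under eq_fun do rewrite gammat_prodE//.
apply/cvg_lim => //; apply: continuous_cvg; first exact: continuous_expR.
exact: cvg_gammat_ln_term.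
Qed.

Lemma ln_gammatE x : 0 < x ->
  ln (gammat x) = - ln x + x * ln 2 + limn (series (gammat_ln_term x)).
Proof.
move=> x0; rewrite gammatE// !lnM ?posrE ?mulr_gt0 ?invr_gt0 ?expR_gt0//.
by rewrite lnV ?posrE// !expRK.
Qed.

Lemma convex_gammat_partial n : convex_function (`]0, +oo[%classic : set R^o)
  (fun x : R^o => - ln x + x * ln 2 + series (gammat_ln_term x) n.*2.+1).
Proof.
elim: n => [|n IHn].
  (* The factor [k = 1] merges with [- ln x] into [ln (1 + x^-1)], leaving the slope [ln 2 - 1]. *)
  have := convex_functionD _ _ _ _ (convex_ln1DV 0 (lexx 0))
    (convex_function_affine _ _ (ln 2 - 1) 0).
  apply: eq_convex_function; last exact: convex_set_pos.
  move=> x /=; rewrite in_itv/= andbT => x0.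
  rewrite seriesEnat/= big_nat1 /gammat_ln_term expr0 mul1r divr1 !addr0.
  have -> : 1 + x^-1 = (1 + x) / x by field; exact: lt0r_neq0.
  by rewrite ln_div ?posrE//; [ring|lra].
(* The two new factors are [k = c] (inverted) and [k = c + 1], with [c = 2n + 2]; their logarithms
   add up to [ln (1 + (x + c)^-1)] plus the affine function below. *)
have c0 : 0 < n.+1.*2%:R :> R by [].
move cE : (n.+1.*2%:R : R) c0 => c c0.
have := convex_functionD _ _ _ _ IHn
  (convex_functionD _ _ _ _ (convex_ln1DV c (ltW c0))
    (convex_function_affine _ _ (c^-1 - (c + 1)^-1) (ln c - ln (c + 1)))).
apply: eq_convex_function; last exact: convex_set_pos.
move=> x /=; rewrite in_itv/= andbT => x0.
rewrite (seriesSr _ n.+1.*2) doubleS (seriesSr _ n.*2.+1) -!addrA.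
do 3!congr (_ + _).
rewrite /gammat_ln_term -!doubleS -signr_odd -[in X in _ = _ + X]signr_odd.
rewrite /= odd_double /= expr1 expr0 mulN1r mul1r -[n.+1.*2.+1]addn1 natrD cE.
have -> : 1 + (x + c)^-1 = (x + c + 1) / (x + c) by field; apply: lt0r_neq0; lra.
have -> : 1 + x / c = (x + c) / c by field; apply: lt0r_neq0; lra.
have -> : 1 + x / (c + 1) = (x + c + 1) / (c + 1) by field; apply: lt0r_neq0; lra.
by rewrite !ln_div ?posrE//; lra.
Qed.

End Gammat.

Theorem theorem2p16 (R : realType) :
  (forall x : R, 0 < x -> 0 < gammat x) /\
  convex_function (`]0, +oo[%classic : set R^o) (fun x : R^o => ln (gammat x)).
Proof.
split=> [x x0|].
  by rewrite gammatE// !mulr_gt0 ?invr_gt0 ?expR_gt0.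
apply: (convex_function_cvg _ _ _ _ _ (@convex_gammat_partial R)).
  exact: convex_set_pos.
move=> x /=; rewrite in_itv/= andbT => x0; rewrite ln_gammatE//.
apply: cvgD; first exact: cvg_cst.
(* The odd-length partial sums share the limit of the whole convergent series. *)
have odd_cvg : n.*2.+1 @[n --> \oo] --> \oo.
  apply/cvgnyPge => m; exists m => // k /= mk.
  by rewrite leqW// -addnn (leq_trans mk)// leq_addr.
apply: cvg_comp odd_cvg _; exact: cvg_gammat_ln_term.
Qed.
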